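(* Let $a=1+a_2\mathbf j+a_3\mathbf k$ with $a_2,a_3\in\mathbb R$, $a_2^2+a_3^2=1$, let $b=b_1\mathbf i+b_2\mathbf j+b_3\mathbf k\ne0$ and $c=c_0+c_1\mathbf i+c_2\mathbf j+c_3\mathbf k\in\mathbb H_s$. Put $\delta=a_2b_3-a_3b_2+b_1$, $t_1=c_2-c_0a_2-a_3c_1$, $t_2=c_3-c_0a_3+a_2c_1$, and assume $P_{ab}=0$ and $\delta=2b_1$ (so that also $I_b=0$). The equation $ax^2+bx+c=0$ has a solution $x\in\mathbb H_s$ with $2\Re(x)a+b\in Z(\mathbb H_s)$ if and only if the following holds (Condition C): if $a_2t_1+a_3t_2=0$, then $a_2t_2-a_3t_1-2c_1=0$ and $t_1^2+t_2^2+4b_1^2c_0=0$. If Condition C holds, then: (1) If $a_2t_1+a_3t_2\ne0$, the equation has the solution $x=x_0+x_1\mathbf i+x_2\mathbf j+x_3\mathbf k$, where $$x_0=\frac{(a_3t_1-a_2t_2+2c_1)b_1}{2(a_2t_1+a_3t_2)},\quad x_1=-\frac{t_1^2+t_2^2+2b_1^2(a_2t_1+a_3t_2)+4b_1^2c_0}{4b_1(a_2t_1+a_3t_2)},$$ $$x_2=-a_2x_0-a_3x_1-\frac{t_2}{2b_1},\quad x_3=-a_3x_0+a_2x_1+\frac{t_1}{2b_1}.$$ (2) If $a_2t_1+a_3t_2=0$, the equation has the solutions $x=x_0+x_1\mathbf i+x_2\mathbf j+x_3\mathbf k$ for all $x_0,x_1\in\mathbb R$, where $$x_2=-a_2x_0-a_3x_1-\frac{t_2}{2b_1},\quad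 x_3=-a_3x_0+a_2x_1+\frac{t_1}{2b_1}.$$
   Context: $\mathbb H_s$ is the split quaternion algebra: the 4-dimensional associative real algebra with basis $1,\mathbf i,\mathbf j,\mathbf k$ and $\mathbf i^2=-1$, $\mathbf j^2=\mathbf k^2=1$, $\mathbf i\mathbf j=\mathbf k=-\mathbf j\mathbf i$, $\mathbf j\mathbf k=-\mathbf i=-\mathbf k\mathbf j$, $\mathbf k\mathbf i=\mathbf j=-\mathbf i\mathbf k$. For $x=x_0+x_1\mathbf i+x_2\mathbf j+x_3\mathbf k$ and $y=y_0+y_1\mathbf i+y_2\mathbf j+y_3\mathbf k$ with real coefficients: $\Re(x)=x_0$, $P_{xy}=\langle x,y\rangle=x_0y_0+x_1y_1-x_2y_2-x_3y_3$, $I_x=\langle x,x\rangle$, $Z(\mathbb H_s)=\{x\in\mathbb H_s:I_x=0\}$. Under the hypotheses, $b_1\ne0$. *)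

(* Defs.v *)
From HB Require Import structures.
From mathcomp Require Import all_boot all_order all_algebra.
From mathcomp Require Import ring.

Set Implicit Arguments.
Unset Strict Implicit.
Unset Printing Implicit Defensive.

Import GRing.Theory.
Local Open Scope ring_scope.

(* The definitions make sense over any commutative ring; the split quaternion
   algebra H_s is [splitQuat R] with R the field of real numbers. *)

(* [SplitQuat x0 x1 x2 x3] is x0 + x1 i + x2 j + x3 k, see [splitQuatE]. *)
Record splitQuat (R : Type) : Type :=
  SplitQuat { sq0 : R; sq1 : R; sq2 : R; sq3 : R }.

Definition splitQuat_tuple (R : Type) (x : splitQuat R) : R * R * R * R :=
  (sq0 x, sq1 x, sq2 x, sq3 x).

Definition tuple_splitQuat (R : Type) (u : R * R * R * R) : splitQuat R :=
  let: (x0, x1, x2, x3) := u in SplitQuat x0 x1 x2 x3.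

Lemma splitQuat_tupleK (R : Type) :
  cancel (@splitQuat_tuple R) (@tuple_splitQuat R).
Proof. by case. Qed.

HB.instance Definition _ (R : choiceType) :=
  Choice.copy (splitQuat R) (can_type (@splitQuat_tupleK R)).

Section Algebra.

Variable R : comNzRingType.
Implicit Types (x y z : splitQuat R) (r s : R).

Definition sqadd x y : splitQuat R :=
  SplitQuat (sq0 x + sq0 y) (sq1 x + sq1 y) (sq2 x + sq2 y) (sq3 x + sq3 y).

Definition sqopp x : splitQuat R :=
  SplitQuat (- sq0 x) (- sq1 x) (- sq2 x) (- sq3 x).

(* The bilinear extension of the multiplication table in [sq_table] below. *)
Definition sqmul x y : splitQuat R :=
  SplitQuat
    (sq0 x * sq0 y - sq1 x * sq1 y + sq2 x * sq2 y + sq3 x * sq3 y)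
    (sq0 x * sq1 y + sq1 x * sq0 y - sq2 x * sq3 y + sq3 x * sq2 y)
    (sq0 x * sq2 y + sq2 x * sq0 y - sq1 x * sq3 y + sq3 x * sq1 y)
    (sq0 x * sq3 y + sq3 x * sq0 y + sq1 x * sq2 y - sq2 x * sq1 y).

Definition sqscale r x : splitQuat R :=
  SplitQuat (r * sq0 x) (r * sq1 x) (r * sq2 x) (r * sq3 x).

Lemma sqaddA : associative sqadd.
Proof. by case=> ? ? ? ? [? ? ? ?] [? ? ? ?]; rewrite /sqadd /= !addrA. Qed.

Lemma sqaddC : commutative sqadd.
Proof. by case=> ? ? ? ? [? ? ? ?]; congr SplitQuat; apply: addrC. Qed.

Lemma sqadd0 : left_id (SplitQuat 0 0 0 0) sqadd.
Proof. by case=> *; rewrite /sqadd /= !add0r. Qed.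

Lemma sqaddN : left_inverse (SplitQuat 0 0 0 0) sqopp sqadd.
Proof. by case=> *; rewrite /sqadd /= !addNr. Qed.

HB.instance Definition _ :=
  GRing.isZmodule.Build (splitQuat R) sqaddA sqaddC sqadd0 sqaddN.

Lemma sqmulA : associative sqmul.
Proof.
by case=> ? ? ? ? [? ? ? ?] [? ? ? ?]; congr SplitQuat; rewrite /=; ring.
Qed.

Lemma sqmul1l : left_id (SplitQuat 1 0 0 0) sqmul.
Proof. by case=> *; congr SplitQuat; rewrite /=; ring. Qed.

Lemma sqmul1r : right_id (SplitQuat 1 0 0 0) sqmul.
Proof. by case=> *; congr SplitQuat; rewrite /=; ring. Qed.

Lemma sqmulDl : left_distributive sqmul sqadd.
Proof.
by case=> ? ? ? ? [? ? ? ?] [? ? ? ?]; congr SplitQuat; rewrite /=; ring.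
Qed.

Lemma sqmulDr : right_distributive sqmul sqadd.
Proof.
by case=> ? ? ? ? [? ? ? ?] [? ? ? ?]; congr SplitQuat; rewrite /=; ring.
Qed.

Lemma sq1_neq0 : SplitQuat 1 0 0 0 != 0 :> splitQuat R.
Proof. by apply/eqP => -[] /eqP; rewrite oner_eq0. Qed.

HB.instance Definition _ :=
  GRing.Zmodule_isNzRing.Build (splitQuat R)
    sqmulA sqmul1l sqmul1r sqmulDl sqmulDr sq1_neq0.

Lemma sqscaleA r s x : sqscale r (sqscale s x) = sqscale (r * s) x.
Proof. by congr SplitQuat; rewrite /= mulrA. Qed.

Lemma sqscale1 : left_id 1 sqscale.
Proof. by case=> *; rewrite /sqscale /= !mul1r. Qed.

Lemma sqscaleDr : right_distributive sqscale +%R.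
Proof. by move=> r x y; congr SplitQuat; rewrite /= mulrDr. Qed.

Lemma sqscaleDl x : {morph sqscale^~ x : r s / r + s}.
Proof. by move=> r s; congr SplitQuat; rewrite /= mulrDl. Qed.

HB.instance Definition _ :=
  GRing.Zmodule_isLmodule.Build R (splitQuat R)
    sqscaleA sqscale1 sqscaleDr sqscaleDl.

Lemma sqscaleAl r x y : r *: (x * y) = r *: x * y.
Proof. by congr SplitQuat; rewrite /=; ring. Qed.

HB.instance Definition _ :=
  GRing.Lmodule_isLalgebra.Build R (splitQuat R) sqscaleAl.

Lemma sqscaleAr r x y : r *: (x * y) = x * (r *: y).
Proof. by congr SplitQuat; rewrite /=; ring. Qed.

HB.instance Definition _ :=
  GRing.Lalgebra_isAlgebra.Build R (splitQuat R) sqscaleAr.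

Definition sqi : splitQuat R := SplitQuat 0 1 0 0.
Definition sqj : splitQuat R := SplitQuat 0 0 1 0.
Definition sqk : splitQuat R := SplitQuat 0 0 0 1.

Lemma sq_table :
  [/\ sqi * sqi = -1, sqj * sqj = 1 & sqk * sqk = 1] /\
  [/\ sqi * sqj = sqk, sqj * sqk = - sqi & sqk * sqi = sqj] /\
  [/\ sqj * sqi = - sqk, sqk * sqj = sqi & sqi * sqk = - sqj].
Proof. by do !split; congr SplitQuat; rewrite /=; ring. Qed.

Lemma splitQuatE (x0 x1 x2 x3 : R) :
  SplitQuat x0 x1 x2 x3 = x0%:A + x1 *: sqi + x2 *: sqj + x3 *: sqk.
Proof. by congr SplitQuat; rewrite /=; ring. Qed.

Definition sqRe x : R := sq0 x.

Definition sqP x y : R :=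
  sq0 x * sq0 y + sq1 x * sq1 y - sq2 x * sq2 y - sq3 x * sq3 y.

Definition sqI x : R := sqP x x.

Definition sqZ : {pred splitQuat R} := [pred x | sqI x == 0].

End Algebra.

Arguments sqi {R}.
Arguments sqj {R}.
Arguments sqk {R}.
Arguments sqZ {R}.

(* Main.v *)
Require Import Defs.
From HB Require Import structures.
From mathcomp Require Import all_boot all_order all_algebra.
From mathcomp Require Import reals ring.

Import GRing.Theory.
Local Open Scope ring_scope.

(** Write u = a2 j + a3 k, so that u^2 = 1 and a = 1 + u.  The hypotheses
    P_ab = 0 and delta = 2 b1 force b = b1 i a, hence 2 Re(x) a + b =
    (2 Re(x) + b1 i) a is always null and only the equation matters.

    As u^2 = 1 and i anticommutes with u, one has (1 - u) a = 0, a i a = 0,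
    a a = 2 a and (1 - u) i a = 2 i a.  Multiplying a x^2 + b1 i a x + c = 0 on the left by
    1 - u kills the quadratic term and leaves the linear equation
    2 b1 i a x + (1 - u) c = 0; multiplying it by a = 1 + u kills the middle
    term and leaves 2 a x^2 + a c = 0.  Since (1 + u) + (1 - u) = 2, the two
    together are equivalent to the equation.

    Since a u = a, every y satisfies a y = a (p + q i) with real p and q that
    depend linearly on y.  The first equation prescribes p and q for y = x,
    which amounts to the formulas for x2 and x3 and yields q = - T / (2 b1),
    where T = a2 t1 + a3 t2.  The second then becomes linear in x, because
    a x^2 = (a x) x = a (p + q i) x and p, q are known; it is a diagonal
    system in x0 and x1 whose coefficients are T up to nonzero factors (lemma
    [eqn_linear_system]).  If T <> 0 it has one solution; if T = 0 it says
    that its two right-hand sides vanish, which is Condition C, and x0, x1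
    stay free. *)

(** [lpart0 a2 a3 y] and [lpart1 a2 a3 y] are the real p and q such that
    (1 + u) y = (1 + u) (p + q i); negating a2 and a3 gives those for 1 - u. *)
Definition lpart0 {R : comNzRingType} (a2 a3 : R) (y : splitQuat R) : R :=
  sq0 y + a2 * sq2 y + a3 * sq3 y.

Definition lpart1 {R : comNzRingType} (a2 a3 : R) (y : splitQuat R) : R :=
  sq1 y + a3 * sq2 y - a2 * sq3 y.

(** An element killed by both 1 + u and 1 - u is killed by their sum 2. *)
Lemma lpart_eq0 (R : idomainType) (a2 a3 : R) (y : splitQuat R) :
  2 != 0 :> R -> a2 ^+ 2 + a3 ^+ 2 = 1 ->
  y = 0 <->
  [/\ lpart0 a2 a3 y = 0, lpart1 a2 a3 y = 0,
      lpart0 (- a2) (- a3) y = 0 & lpart1 (- a2) (- a3) y = 0].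
Proof.
move=> two_neq0 norm_u; split=> [-> | ].
  by split; rewrite /lpart0 /lpart1 /=; ring.
case: y => y0 y1 y2 y3; rewrite /lpart0 /lpart1 /= => -[p0 q0 p0' q0'].
have half (r : R) : 2 * r = 0 -> r = 0.
  by move/eqP; rewrite mulf_eq0 (negPf two_neq0) => /eqP.
have y00 : y0 = 0.
  apply: half.
  transitivity ((y0 + a2 * y2 + a3 * y3) + (y0 + - a2 * y2 + - a3 * y3)).
    by ring.
  by rewrite p0 p0' addr0.
have y10 : y1 = 0.
  apply: half.
  transitivity ((y1 + a3 * y2 - a2 * y3) + (y1 + - a3 * y2 - - a2 * y3)).
    by ring.
  by rewrite q0 q0' addr0.
rewrite y00 in p0; rewrite y10 in q0.
have y20 : y2 = 0.
  transitivity ((a2 ^+ 2 + a3 ^+ 2) * y2); first by rewrite norm_u mul1r.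
  transitivity (a2 * (0 + a2 * y2 + a3 * y3) + a3 * (0 + a3 * y2 - a2 * y3)).
    by ring.
  by rewrite p0 q0; ring.
have y30 : y3 = 0.
  transitivity ((a2 ^+ 2 + a3 ^+ 2) * y3); first by rewrite norm_u mul1r.
  transitivity (a3 * (0 + a2 * y2 + a3 * y3) - a2 * (0 + a3 * y2 - a2 * y3)).
    by ring.
  by rewrite p0 q0; ring.
by rewrite y00 y10 y20 y30.
Qed.

(** The equation multiplied on the left by 1 + u and by 1 - u, in coordinates.
    In the 1 + u part the square of x enters through a x^2 = a (p + q i) x,
    whose coordinates are linear in x once p and q are fixed. *)
Lemma lpart_eqn (R : comNzRingType) (a2 a3 b1 : R) (x c : splitQuat R) :
  a2 ^+ 2 + a3 ^+ 2 = 1 ->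
  let a : splitQuat R := 1 + a2 *: sqj + a3 *: sqk in
  let y := a * x ^+ 2 + b1 *: (sqi * a) * x + c in
  let p := lpart0 a2 a3 x in
  let q := lpart1 a2 a3 x in
  [/\ lpart0 a2 a3 y
        = 2 * (p ^+ 2 + q ^+ 2 - 2 * q * sq1 x) + lpart0 a2 a3 c,
      lpart1 a2 a3 y = 4 * q * sq0 x + lpart1 a2 a3 c,
      lpart0 (- a2) (- a3) y = - (2 * b1 * q) + lpart0 (- a2) (- a3) c &
      lpart1 (- a2) (- a3) y = 2 * b1 * p + lpart1 (- a2) (- a3) c].
Proof.
move=> norm_u /=.
have a2sq : a2 ^+ 2 = 1 - a3 ^+ 2 by rewrite -norm_u addrK.
case: x c => x0 x1 x2 x3 [c0 c1 c2 c3].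
by split; rewrite /lpart0 /lpart1 /=; ring: a2sq.
Qed.

(** P_ab = 0 and delta = 2 b1 give the scalar and cross products of (a2, a3)
    and (b2, b3); as (a2, a3) is a unit vector they determine (b2, b3). *)
Lemma b_eq_ia (R : comNzRingType) (a2 a3 b1 b2 b3 : R) :
  let a : splitQuat R := 1 + a2 *: sqj + a3 *: sqk in
  let b : splitQuat R := b1 *: sqi + b2 *: sqj + b3 *: sqk in
  a2 ^+ 2 + a3 ^+ 2 = 1 -> sqP a b = 0 ->
  a2 * b3 - a3 * b2 + b1 = 2 * b1 -> b = b1 *: (sqi * a).
Proof.
move=> a b norm_u Pab0 delta2.
have dot : a2 * b2 + a3 * b3 = 0.
  by apply: oppr_inj; rewrite oppr0 -Pab0 /a /b /sqP /=; ring.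
have cross : a2 * b3 - a3 * b2 = b1.
  by apply: (addIr b1); rewrite delta2; ring.
have b2E : b2 = - (a3 * b1).
  transitivity ((a2 ^+ 2 + a3 ^+ 2) * b2); first by rewrite norm_u mul1r.
  transitivity (a2 * (a2 * b2 + a3 * b3) - a3 * (a2 * b3 - a3 * b2)).
    by ring.
  by rewrite dot cross; ring.
have b3E : b3 = a2 * b1.
  transitivity ((a2 ^+ 2 + a3 ^+ 2) * b3); first by rewrite norm_u mul1r.
  transitivity (a3 * (a2 * b2 + a3 * b3) + a2 * (a2 * b3 - a3 * b2)).
    by ring.
  by rewrite dot cross; ring.
by rewrite /a /b b2E b3E; congr SplitQuat; rewrite /=; ring.
Qed.

(** The element is (r + b1 i) a, and I is multiplicative with I_a = 0. *)
Lemma scale_a_add_ia_null (R : comNzRingType) (a2 a3 b1 r : R) :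
  let a : splitQuat R := 1 + a2 *: sqj + a3 *: sqk in
  a2 ^+ 2 + a3 ^+ 2 = 1 -> r *: a + b1 *: (sqi * a) \in sqZ.
Proof.
move=> /= norm_u; rewrite inE; apply/eqP.
have a2sq : a2 ^+ 2 = 1 - a3 ^+ 2 by rewrite -norm_u addrK.
by rewrite /sqI /sqP /=; ring: a2sq.
Qed.

(** The quadratic equation is a linear system: the 1 - u part gives x2 and x3
    in terms of x0 and x1, and then the 1 + u part is diagonal in x0, x1. *)
Lemma eqn_linear_system (F : fieldType) (a2 a3 b1 c0 c1 c2 c3 : F)
    (x0 x1 x2 x3 : F) :
  2 != 0 :> F -> b1 != 0 -> a2 ^+ 2 + a3 ^+ 2 = 1 ->
  let a : splitQuat F := 1 + a2 *: sqj + a3 *: sqk in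
  let x := SplitQuat x0 x1 x2 x3 in
  let c := SplitQuat c0 c1 c2 c3 in
  let t1 := c2 - c0 * a2 - a3 * c1 in
  let t2 := c3 - c0 * a3 + a2 * c1 in
  let T := a2 * t1 + a3 * t2 in
  a * x ^+ 2 + b1 *: (sqi * a) * x + c = 0 <->
  [/\ x2 = - (a2 * x0) - a3 * x1 - t2 / (2 * b1),
      x3 = - (a3 * x0) + a2 * x1 + t1 / (2 * b1),
      2 * T * x0 = (a3 * t1 - a2 * t2 + 2 * c1) * b1 &
      4 * b1 * T * x1 = - (t1 ^+ 2 + t2 ^+ 2 + 2 * b1 ^+ 2 * T
                           + 4 * b1 ^+ 2 * c0)].
Proof.
move=> two_neq0 b1_neq0 norm_u a x c t1 t2 T.
have a2sq : a2 ^+ 2 = 1 - a3 ^+ 2 by rewrite -norm_u addrK.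
set S := a3 * t1 - a2 * t2.
set p := lpart0 a2 a3 x; set q := lpart1 a2 a3 x.
have cP : lpart0 a2 a3 c = T + 2 * c0.
  by rewrite /lpart0 /T /t1 /t2 /=; ring: a2sq.
have cQ : lpart1 a2 a3 c = S + 2 * c1.
  by rewrite /lpart1 /S /t1 /t2 /=; ring: a2sq.
have cP' : lpart0 (- a2) (- a3) c = - T.
  by rewrite /lpart0 /T /t1 /t2 /=; ring: a2sq.
have cQ' : lpart1 (- a2) (- a3) c = - S.
  by rewrite /lpart1 /S /t1 /t2 /=; ring: a2sq.
have ST : T ^+ 2 + S ^+ 2 = t1 ^+ 2 + t2 ^+ 2.
  by rewrite /T /S; ring: a2sq.
have x23 : (q = - T / (2 * b1) /\ p = S / (2 * b1)) <->
    (x2 = - (a2 * x0) - a3 * x1 - t2 / (2 * b1) /\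
     x3 = - (a3 * x0) + a2 * x1 + t1 / (2 * b1)).
  split=> [[qE pE] | [x2E x3E]].
    (* (x2, x3) is recovered from p - x0 and q - x1, its scalar and cross
       products with the unit vector (a2, a3). *)
    have -> : x2 = a2 * (p - x0) + a3 * (q - x1).
      by rewrite /p /q /lpart0 /lpart1 /=; ring: a2sq.
    have -> : x3 = a3 * (p - x0) - a2 * (q - x1).
      by rewrite /p /q /lpart0 /lpart1 /=; ring: a2sq.
    by rewrite qE pE /S /T; split; ring: a2sq.
  by rewrite /p /q /lpart0 /lpart1 /= x2E x3E /S /T; split; ring: a2sq.
have b2_neq0 : 2 * b1 != 0 by rewrite mulf_neq0.
have solve_q : - (2 * b1 * q) + - T = 0 <-> q = - T / (2 * b1).
  split=> [/eqP | ->]; last by field; apply/andP.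
  by rewrite addr_eq0 opprK => /eqP <-; field; apply/andP.
have solve_p : 2 * b1 * p + - S = 0 <-> p = S / (2 * b1).
  split=> [/eqP | ->]; last by field; apply/andP.
  by rewrite addr_eq0 opprK => /eqP <-; field; apply/andP.
have [y0 y1 y0' y1'] := lpart_eqn _ a2 a3 b1 x c norm_u.
rewrite (lpart_eq0 _ a2 a3) // /a y0 y1 y0' y1' cP cQ cP' cQ' -/p -/q.
rewrite -[sq0 x]/x0 -[sq1 x]/x1.
have scale_eq0 (k r s : F) : k != 0 -> k * r = s -> (r = 0 <-> s = 0).
  move=> k_neq0 <-; split=> [-> | /eqP]; first by rewrite mulr0.
  by rewrite mulf_eq0 (negPf k_neq0) => /eqP.
have diag : q = - T / (2 * b1) -> p = S / (2 * b1) ->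
    (4 * q * x0 + (S + 2 * c1) = 0 <-> 2 * T * x0 = (S + 2 * c1) * b1) /\
    (2 * (p ^+ 2 + q ^+ 2 - 2 * q * x1) + (T + 2 * c0) = 0 <->
     4 * b1 * T * x1 = - (t1 ^+ 2 + t2 ^+ 2 + 2 * b1 ^+ 2 * T
                          + 4 * b1 ^+ 2 * c0)).
  move=> -> ->; split.
    rewrite (scale_eq0 (- b1) _ (2 * T * x0 - (S + 2 * c1) * b1)).
    - by rewrite (rwP eqP) subr_eq0 -(rwP eqP).
    - by rewrite oppr_eq0.
    - by field; apply/andP.
  rewrite (scale_eq0 (2 * b1 ^+ 2) _ (4 * b1 * T * x1 +
      (t1 ^+ 2 + t2 ^+ 2 + 2 * b1 ^+ 2 * T + 4 * b1 ^+ 2 * c0))).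
  - by rewrite (rwP eqP) addr_eq0 -(rwP eqP).
  - by rewrite mulf_neq0 // expf_neq0.
  - by rewrite -ST; field; apply/andP.
split=> [[yP yQ yP' yQ'] | [x2E x3E x0E x1E]].
  have qE := solve_q.1 yP'; have pE := solve_p.1 yQ'.
  have [x2E x3E] := x23.1 (conj qE pE).
  have [d0 d1] := diag qE pE.
  by split=> //; [apply/d0 | apply/d1].
have [qE pE] := x23.2 (conj x2E x3E).
have [d0 d1] := diag qE pE.
by split; [apply/d1 | apply/d0 | apply/solve_q | apply/solve_p].
Qed.

Theorem theorem5p2 (R : realType) (a2 a3 b1 b2 b3 c0 c1 c2 c3 : R) :
  let a : splitQuat R := 1 + a2 *: sqj + a3 *: sqk in
  let b : splitQuat R := b1 *: sqi + b2 *: sqj + b3 *: sqk in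
  let c : splitQuat R := c0%:A + c1 *: sqi + c2 *: sqj + c3 *: sqk in
  let delta : R := a2 * b3 - a3 * b2 + b1 in
  let t1 : R := c2 - c0 * a2 - a3 * c1 in
  let t2 : R := c3 - c0 * a3 + a2 * c1 in
  let solution (x : splitQuat R) : Prop :=
    a * x ^+ 2 + b * x + c = 0 /\ (2 * sqRe x) *: a + b \in sqZ in
  let conditionC : Prop :=
    a2 * t1 + a3 * t2 = 0 ->
    a2 * t2 - a3 * t1 - 2 * c1 = 0 /\
    t1 ^+ 2 + t2 ^+ 2 + 4 * b1 ^+ 2 * c0 = 0 in
  a2 ^+ 2 + a3 ^+ 2 = 1 ->
  b <> 0 ->
  sqP a b = 0 ->
  delta = 2 * b1 ->
  ((exists x : splitQuat R, solution x) <-> conditionC) /\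
  (conditionC ->
    (a2 * t1 + a3 * t2 <> 0 ->
      let x0 : R :=
        (a3 * t1 - a2 * t2 + 2 * c1) * b1 / (2 * (a2 * t1 + a3 * t2)) in
      let x1 : R :=
        - ((t1 ^+ 2 + t2 ^+ 2 + 2 * b1 ^+ 2 * (a2 * t1 + a3 * t2)
            + 4 * b1 ^+ 2 * c0) / (4 * b1 * (a2 * t1 + a3 * t2))) in
      let x2 : R := - (a2 * x0) - a3 * x1 - t2 / (2 * b1) in
      let x3 : R := - (a3 * x0) + a2 * x1 + t1 / (2 * b1) in
      forall x : splitQuat R,
        solution x <-> x = x0%:A + x1 *: sqi + x2 *: sqj + x3 *: sqk) /\
    (a2 * t1 + a3 * t2 = 0 ->
      forall x : splitQuat R,
        solution x <->
        exists x0 x1 : R,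
          let x2 : R := - (a2 * x0) - a3 * x1 - t2 / (2 * b1) in
          let x3 : R := - (a3 * x0) + a2 * x1 + t1 / (2 * b1) in
          x = x0%:A + x1 *: sqi + x2 *: sqj + x3 *: sqk)).
Proof.
move=> a b c delta t1 t2 solution conditionC norm_u b_neq0 Pab0 deltaE.
have bE : b = b1 *: (sqi * a) by apply: b_eq_ia.
have two_neq0 : 2 != 0 :> R by rewrite Num.Theory.pnatr_eq0.
have b1_neq0 : b1 != 0.
  by apply/eqP => b10; apply: b_neq0; rewrite bE b10 scale0r.
have cE : c = SplitQuat c0 c1 c2 c3 by rewrite splitQuatE.
set T := a2 * t1 + a3 * t2 in conditionC *.
pose N := t1 ^+ 2 + t2 ^+ 2 + 2 * b1 ^+ 2 * T + 4 * b1 ^+ 2 * c0.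
pose x2_of x0 x1 := - (a2 * x0) - a3 * x1 - t2 / (2 * b1).
pose x3_of x0 x1 := - (a3 * x0) + a2 * x1 + t1 / (2 * b1).
have solP x0 x1 x2 x3 : solution (SplitQuat x0 x1 x2 x3) <->
    [/\ x2 = x2_of x0 x1, x3 = x3_of x0 x1,
        2 * T * x0 = (a3 * t1 - a2 * t2 + 2 * c1) * b1 &
        4 * b1 * T * x1 = - N].
  rewrite /N -eqn_linear_system // /solution -/a bE cE.
  split=> [[] // | eqn0]; split=> //.
  exact: scale_a_add_ia_null.
have case_neq0 : T <> 0 ->
    let x0 := (a3 * t1 - a2 * t2 + 2 * c1) * b1 / (2 * T) in
    let x1 := - (N / (4 * b1 * T)) in
    forall x, solution x <->
      x = x0%:A + x1 *: sqi + x2_of x0 x1 *: sqj + x3_of x0 x1 *: sqk.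
  move=> /eqP T_neq0 x0 x1 [y0 y1 y2 y3]; rewrite -splitQuatE solP.
  have four_neq0 : 4 != 0 :> R by rewrite Num.Theory.pnatr_eq0.
  have k0 : 2 * T != 0 by rewrite mulf_neq0.
  have k1 : 4 * b1 * T != 0 by rewrite !mulf_neq0.
  split=> [[-> -> y0E y1E] | [-> -> -> ->]].
    have -> : y0 = x0 by apply: (mulfI k0); rewrite y0E [RHS]mulrC divfK.
    suff -> : y1 = x1 by [].
    by apply: (mulfI k1); rewrite y1E mulrN (mulrC (4 * b1 * T)) divfK.
  by split=> //; rewrite ?mulrN mulrC divfK.
have case_eq0 : conditionC -> T = 0 -> forall x, solution x <->
    exists x0 x1,
      x = x0%:A + x1 *: sqi + x2_of x0 x1 *: sqj + x3_of x0 x1 *: sqk.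
  move=> condC T0 [y0 y1 y2 y3]; have [S0 N0] := condC T0; rewrite solP.
  split=> [[-> -> _ _] | [x0 [x1]]].
    by exists y0, y1; rewrite -splitQuatE.
  rewrite -splitQuatE => -[-> -> -> ->]; split=> //.
    rewrite T0 mulr0 mul0r -[LHS]oppr0 -(mul0r b1) -S0; ring.
  by rewrite /N T0 !mulr0 addr0 mul0r N0 oppr0.
split; last by move=> condC; split; [apply: case_neq0 | apply: case_eq0].
split=> [[[x0 x1 x2 x3]] | condC].
  rewrite solP => -[_ _ x0E x1E] T0; split.
    apply: (mulIf b1_neq0); rewrite mul0r -[RHS]oppr0.
    transitivity (- ((a3 * t1 - a2 * t2 + 2 * c1) * b1)); first by ring.
    by rewrite -x0E T0 mulr0 mul0r.
  apply: oppr_inj; rewrite oppr0.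
  by move: x1E; rewrite /N T0 !mulr0 addr0 mul0r.
have [T0 | /eqP T_neq0] := eqVneq T 0.
  (* x0 and x1 are free here; take both to be 0. *)
  by eexists; apply/(case_eq0 condC T0); exists 0, 0.
by eexists; apply/(case_neq0 T_neq0).
Qed.
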